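(* Let $N\ge 1$ be an integer, $x$ a real number and $f:\mathbb{R}\to\mathbb{R}$ an arbitrary function. Then \[ \sum_{n=0}^{2^{N}-1}(-1)^{s_{2}(n)}f(x+n)=(-1)^{N}\sum_{k=0}^{2^{N}-N-1}\alpha_{k}^{(N-1)}\,\Delta^{N}f(x+k), \] where the nonnegative integers $\alpha_k^{(M)}$ are defined by $\sum_{k}\alpha_{k}^{(M)}t^{k}=\prod_{i=0}^{M-1}\left(1+t^{2^{i}}\right)^{M-i}$ (the empty product being $1$).
   Context: $s_2(n)$ is the number of ones in the binary expansion of $n$. $\Delta$ is the forward difference operator $\Delta f(y)=f(y+1)-f(y)$, and $\Delta^N$ is its $N$-th iterate, so $\Delta^N f(y)=\sum_{j=0}^{N}\binom{N}{j}(-1)^{N-j}f(y+j)$. *)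

(* Defs.v *)
(* MathComp world; the real numbers are an abstract realType. *)
From mathcomp Require Import all_boot all_order all_algebra.
From mathcomp Require Import reals.

Set Implicit Arguments.
Unset Strict Implicit.
Unset Printing Implicit Defensive.

Import Order.TTheory GRing.Theory Num.Theory.
Local Open Scope ring_scope.

(* The binary digit of n at position i is the parity of n %/ 2 ^ i; since
   n < 2 ^ n, every digit at a position i >= n is 0. *)
Definition s2 (n : nat) : nat := #|[set i : 'I_n | odd (n %/ 2 ^ i)]|.

Definition fwd_diff (R : realType) (f : R -> R) : R -> R :=
  fun y => f (y + 1) - f y.

Definition fwd_diff_iter (R : realType) (N : nat) (f : R -> R) : R -> R :=
  iter N (@fwd_diff R) f.

(* The generating polynomial is taken over the semiring nat, so its
   coefficients are nonnegative integers by construction. *)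
Definition alpha_gen (M : nat) : {poly nat} :=
  \prod_(0 <= i < M) (1 + 'X^(2 ^ i)) ^+ (M - i).

Definition alpha (M k : nat) : nat := ((alpha_gen M)`_k)%R.

(* Main.v *)
(** Apply polynomials in the shift operator [f |-> f (_ + 1)], which plays the
    role of ['X], to [f]: the operator of the left-hand side is
    [\prod_(i < N) (1 - 'X^(2 ^ i))].  Each factor is
    [(1 - 'X) * \prod_(j < i) (1 + 'X^(2 ^ j))], so the whole product equals
    [(1 - 'X) ^+ N] times the generating polynomial of the [alpha (N - 1) k];
    and ['X - 1] is the forward difference operator. *)
Require Import Defs.
From HB Require Import structures.
From mathcomp Require Import all_boot all_order all_algebra.
From mathcomp Require Import reals.
From mathcomp Require Import zify.

Import Order.TTheory GRing.Theory Num.Theory.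
Local Open Scope ring_scope.

(** Frees the digit count from [n] itself: positions beyond the leading digit contribute 0, so the
    ranges [m] and [n] both extend to [maxn m n]. *)
Lemma s2_sum_odd (n m : nat) :
  (n < 2 ^ m)%N -> s2 n = (\sum_(i < m) odd (n %/ 2 ^ i))%N.
Proof.
have sum_stable (a b : nat) : (a <= b)%N -> (n < 2 ^ a)%N ->
    (\sum_(i < a) odd (n %/ 2 ^ i) = \sum_(i < b) odd (n %/ 2 ^ i))%N.
  move=> le_ab lt_na.
  rewrite (big_ord_widen _ (fun i => nat_of_bool (odd (n %/ 2 ^ i))) le_ab).
  rewrite [RHS](bigID (fun i : 'I_b => (i < a)%N)) /=.
  rewrite [X in (_ + X)%N]big1 ?addn0 // => i.
  rewrite -leqNgt => le_ai; rewrite divn_small //.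
  by apply: leq_trans lt_na _; rewrite leq_exp2l.
move=> lt_nm; rewrite (sum_stable m (maxn m n)) ?leq_maxl //.
rewrite -(sum_stable n (maxn m n)) ?leq_maxr //; last exact: ltn_expl.
rewrite /s2 -sum1_card big_mkcond /=; apply: eq_bigr => i _.
by rewrite inE; case: (odd _).
Qed.

Lemma s2_pow2_add (N n : nat) : (n < 2 ^ N)%N -> s2 (2 ^ N + n) = (s2 n).+1.
Proof.
move=> lt_nN; rewrite (@s2_sum_odd _ N.+1); last by rewrite expnS; lia.
rewrite (@s2_sum_odd _ N) // big_ord_recr /= divnDl ?dvdnn //.
rewrite divnn expn_gt0 /= divn_small //= addn1; congr _.+1.
(* Adding [2 ^ N] raises the quotient by [2 ^ (N - i)], which is even since [i < N]. *)
apply: eq_bigr => i _; rewrite -[in (2 ^ N)%N](subnK (ltnW (ltn_ord i))).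
rewrite expnD divnDl ?dvdn_mull // mulnK ?expn_gt0 // oddD oddX /=.
by rewrite subn_eq0 leqNgt ltn_ord.
Qed.

(** The upper half of the range is the lower half shifted by [2 ^ N] with every sign flipped, hence
    the new factor [1 - 'X^(2 ^ N)]. *)
Lemma sum_sign_s2_Xn (R : nzRingType) (N : nat) :
  \sum_(0 <= n < 2 ^ N) (-1) ^+ s2 n *: 'X^n
    = \prod_(0 <= i < N) (1 - 'X^(2 ^ i)) :> {poly R}.
Proof.
elim: N => [|N IHN].
  by rewrite big_nat1 big_geq // (@s2_sum_odd _ 0) // big_ord0 scale1r.
rewrite big_nat_recr //= -IHN mulrBr mulr1 expnS mul2n -addnn.
rewrite (big_cat_nat (n := 2 ^ N)) ?leq_addr //=; congr (_ + _).
rewrite -{1}[(2 ^ N)%N]add0n big_addn addnK mulr_suml -sumrN.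
rewrite !big_seq; apply: eq_bigr => n; rewrite mem_index_iota => /andP[_ ltn].
by rewrite addnC s2_pow2_add // exprS mulN1r scaleNr -scalerAl -exprD addnC.
Qed.

Lemma one_sub_X_pow2 (R : nzRingType) (i : nat) :
  1 - 'X^(2 ^ i) = (1 - 'X) * \prod_(0 <= j < i) (1 + 'X^(2 ^ j)) :> {poly R}.
Proof.
elim: i => [|i IHi]; first by rewrite big_geq // mulr1.
rewrite big_nat_recr //= mulrA -IHi mulrDr mulr1 mulrBl mul1r -exprD.
by rewrite addnn -mul2n -expnS addrA subrK.
Qed.

(** Passing from [M] to [M.+1] raises each exponent [M - i] by one and adds the factor [i = M] with
    exponent 1. *)
Lemma alpha_genS (M : nat) :
  alpha_gen M.+1 = alpha_gen M * \prod_(0 <= i < M.+1) (1 + 'X^(2 ^ i)).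
Proof.
rewrite /alpha_gen big_nat_recr //= subSnn expr1.
rewrite [\prod_(0 <= i < M.+1) _]big_nat_recr //= mulrA; congr (_ * _).
rewrite -big_split /= !big_seq; apply: eq_bigr => i.
rewrite mem_index_iota => /andP[_ lt_iM].
by rewrite subSn ?(ltnW lt_iM) // exprSr.
Qed.

Lemma size_prod_one_add_X_pow2 (R : nzSemiRingType) (m : nat) :
  (size (\prod_(0 <= i < m) (1 + 'X^(2 ^ i)) : {poly R})%R <= 2 ^ m)%N.
Proof.
elim: m => [|m IHm]; first by rewrite big_geq // size_poly1.
rewrite big_nat_recr //=; apply: leq_trans (size_polyMleq _ _) _.
rewrite -subn1 leq_subLR expnS mul2n -addnn addnCA add1n; apply: leq_add IHm _.
apply: leq_trans (size_polyD _ _) _.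
by rewrite size_poly1 size_polyXn geq_max leqnn andbT.
Qed.

(** With [N = M.+1], this is what bounds the right-hand sum of the theorem. *)
Lemma size_alpha_gen (M : nat) : (size (alpha_gen M) <= 2 ^ M.+1 - M.+1)%N.
Proof.
elim: M => [|M IHM]; first by rewrite /alpha_gen big_geq // size_poly1.
rewrite alpha_genS; apply: leq_trans (size_polyMleq _ _) _.
rewrite -subn1.
apply: leq_trans (leq_sub2r 1 (leq_add IHM (size_prod_one_add_X_pow2 _ _))) _.
(* [M.+1 < 2 ^ M.+1] keeps the truncated subtractions exact. *)
have := ltn_expl M.+1 (ltnSn 1); rewrite (expnS 2 M.+1); lia.
Qed.

Lemma prod_one_sub_X_pow2 (R : comNzRingType) (M : nat) :
  \prod_(0 <= i < M.+1) (1 - 'X^(2 ^ i))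
    = (1 - 'X) ^+ M.+1 * map_poly (GRing.natmul (1 : R)) (alpha_gen M).
Proof.
elim: M => [|M IHM].
  by rewrite big_nat1 /alpha_gen big_geq // rmorph1 mulr1 expr1.
rewrite big_nat_recr //= IHM one_sub_X_pow2 alpha_genS rmorphM /=.
rewrite mulrACA -exprSr; congr (_ * (_ * _)).
rewrite rmorph_prod; apply: eq_bigr => i _.
by rewrite rmorphD rmorph1 /= map_polyXn.
Qed.

Definition shift_eval {R : realType} (f : R -> R) (x : R) (p : {poly R}) : R :=
  \sum_(i < size p) p`_i * f (x + i%:R).

(** Linearity compares polynomials of different sizes, so their sums must first be brought to a
    common range. *)
Lemma shift_eval_wide (R : realType) (f : R -> R) (x : R) (p : {poly R})
    (n : nat) : (size p <= n)%N ->
  shift_eval f x p = \sum_(i < n) p`_i * f (x + i%:R).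
Proof.
move=> le_pn; rewrite /shift_eval.
rewrite (big_ord_widen _ (fun i => p`_i * f (x + i%:R)) le_pn).
rewrite [RHS](bigID (fun i : 'I_n => (i < size p)%N)) /=.
rewrite [X in _ + X]big1 ?addr0 // => i.
by rewrite -leqNgt => le_pi; rewrite nth_default ?mul0r.
Qed.

Lemma shift_eval_is_linear (R : realType) (f : R -> R) (x : R) :
  linear_for *%R (shift_eval f x).
Proof.
move=> a p q; pose n := maxn (size (a *: p + q)) (maxn (size p) (size q)).
rewrite !(@shift_eval_wide _ _ _ _ n) ?leq_max ?leqnn ?orbT //.
rewrite mulr_sumr -big_split; apply: eq_bigr => i _ /=.
by rewrite coefD coefZ mulrDl mulrA.
Qed.

HB.instance Definition _ (R : realType) (f : R -> R) (x : R) :=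
  GRing.isLinear.Build R {poly R} R *%R (shift_eval f x)
    (@shift_eval_is_linear R f x).

Lemma shift_eval_Xn (R : realType) (f : R -> R) (x : R) (k : nat) :
  shift_eval f x 'X^k = f (x + k%:R).
Proof.
rewrite /shift_eval size_polyXn big_ord_recr /= coefXn eqxx mul1r.
rewrite big1 ?add0r // => i _; by rewrite coefXn ltn_eqF ?mul0r.
Qed.

(** One factor ['X - 1] turns ['X^k] into ['X^(k.+1) - 'X^k], so the induction on [N] needs its
    hypothesis at both [k.+1] and [k]. *)
Lemma shift_eval_diff (R : realType) (f : R -> R) (x : R) (N k : nat) :
  shift_eval f x (('X - 1) ^+ N * 'X^k) = fwd_diff_iter N f (x + k%:R).
Proof.
elim: N k => [|N IHN] k; first by rewrite mul1r shift_eval_Xn.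
rewrite exprSr -mulrA mulrBl mul1r -exprS mulrBr raddfB /= !IHN.
by rewrite /= /fwd_diff -natr1 addrA.
Qed.

Theorem theorem17 (R : realType) (N : nat) (hN : (1 <= N)%N) (x : R)
    (f : R -> R) :
  \sum_(0 <= n < 2 ^ N) (-1) ^+ s2 n * f (x + n%:R) =
  (-1) ^+ N *
    \sum_(0 <= k < (2 ^ N - N - 1).+1)
      (alpha (N - 1) k)%:R * fwd_diff_iter N f (x + k%:R).
Proof.
case: N hN => [//|M] _; rewrite [(M.+1 - 1)%N]subSS subn0.
transitivity
    (shift_eval f x (\sum_(0 <= n < 2 ^ M.+1) (-1) ^+ s2 n *: 'X^n)).
  rewrite linear_sum; apply: eq_bigr => n _.
  by rewrite linearZ /= shift_eval_Xn.
rewrite sum_sign_s2_Xn prod_one_sub_X_pow2.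
have -> : (2 ^ M.+1 - M.+1 - 1).+1 = (2 ^ M.+1 - M.+1)%N.
  by have := ltn_expl M.+1 (ltnSn 1); lia.
(* The coefficients are carried from [nat] to [R]; the size bound makes the truncated sum the whole
   polynomial. *)
have -> : map_poly (GRing.natmul (1 : R)) (alpha_gen M)
    = \sum_(0 <= k < 2 ^ M.+1 - M.+1) (alpha M k)%:R *: 'X^k.
  rewrite big_mkord -(poly_def _ (fun k => (alpha M k)%:R)); apply/polyP => k.
  rewrite coef_map coef_poly /=; case: ltnP => // le_k.
  by rewrite nth_default // (leq_trans (size_alpha_gen M)).
(* The sign [(-1) ^+ N] comes from writing [1 - 'X] as [-1 *: ('X - 1)]. *)
rewrite -opprB -scaleN1r exprZn -scalerAl linearZ /=.
rewrite [in shift_eval f x _]mulr_sumr linear_sum.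
congr (_ * _); apply: eq_bigr => k _.
by rewrite -scalerAr linearZ /= shift_eval_diff.
Qed.
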